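(* Let $s\ge1$ be odd, and let $n,k$ be integers with $n\ge 2k$ and $k\ge s+2$. Let $\mathcal{F}\subset\binom{[n]}{k}$ be an $s$-subset-regular intersecting family. Then $$|\mathcal{F}|\le \frac{\binom{n}{k}}{1+\frac{\binom{n-k}{k}}{\binom{n-k-s-2}{k-s-2}}}.$$ Moreover, if $n>2k$ and equality holds, then the characteristic vector $\chi$ of $\mathcal{F}$ lies in $V_0+V_{s+2}$.
   Context: $[n]=\{1,\dots,n\}$, $\binom{[n]}{k}$ is the set of $k$-subsets of $[n]$. A family is intersecting if any two members intersect. $\mathcal{F}$ is $s$-subset-regular if every $s$-element subset of $[n]$ is contained in the same number of members of $\mathcal{F}$. Work in the real vector space $\mathbb{R}^{\binom{[n]}{k}}$ with the standard inner product; the characteristic vector $\chi$ of $\mathcal{F}$ has entry $1$ at $F\in\mathcal{F}$ and $0$ elsewhere. For $S\subset[n]$ let $\psi_S$ be the characteristic vector of $\{A\in\binom{[n]}{k}:S\subset A\}$. For $0\le j\le k$ let $W_j=\operatorname{span}\{\psi_S:|S|=j\}$ (so $W_0$ is spanned by the all-ones vector), and set $V_0=W_0$ and $V_j=W_j\cap W_{j-1}^{\perp}$ for $1\le j\le k$. (These $V_j$ are the common eigenspaces of the Johnson scheme in the standard ordering.) *)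

(* Defs.v *)
From HB Require Import structures.
From mathcomp Require Import all_boot all_order all_algebra.
From mathcomp Require Import reals.

Set Implicit Arguments.
Unset Strict Implicit.
Unset Printing Implicit Defensive.
Import Order.TTheory GRing.Theory Num.Theory.
Local Open Scope ring_scope.

(* The ground set [n] is modelled by 'I_n, i.e. {0, ..., n-1}. *)

Definition intersecting n (F : {set {set 'I_n}}) : Prop :=
  forall A B, A \in F -> B \in F -> A :&: B != set0.

Definition subset_regular n (s : nat) (F : {set {set 'I_n}}) : Prop :=
  exists d : nat, forall S : {set 'I_n},
    #|S| = s -> #|[set A in F | S \subset A]| = d.

Definition ksubset (n k : nat) := {A : {set 'I_n} | #|A| == k}.

Section Johnson.
Variables (R : realType) (n k : nat).

Definition jspace : vectType R := {ffun ksubset n k -> R^o}.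

Definition jdot (u v : jspace) : R := \sum_(A : ksubset n k) u A * v A.

Fact jdot_bilinear :
  bilinear_for (GRing.Scale.Law.clone _ _ *%R _)
               (GRing.Scale.Law.clone _ _ (idfun \; *%R) _) jdot.
Proof.
split=> w a u v; rewrite /jdot /= mulr_sumr -big_split; apply: eq_bigr => A _.
  by rewrite !ffunE mulrDl mulrA.
by rewrite !ffunE mulrDr mulrCA.
Qed.

HB.instance Definition _ := bilinear_isBilinear.Build R jspace jspace R
  _ _ jdot jdot_bilinear.

Fact jdot_sym (u v : jspace) : jdot u v = (-1) ^+ false * idfun (jdot v u).
Proof. by rewrite mul1r; apply: eq_bigr => A _; rewrite mulrC. Qed.

HB.instance Definition _ :=
  isHermitianSesquilinear.Build R jspace false idfun jdot jdot_sym.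

Fact jdot_gt0 (u : jspace) : u != 0 -> 0 < jdot u u.
Proof.
move=> u0; have ge0 A : true -> 0 <= u A * u A by rewrite -expr2 sqr_ge0.
rewrite lt_neqAle sumr_ge0 // andbT eq_sym.
apply: contra u0 => /eqP/(psumr_eq0P ge0) uu0.
by apply/eqP/ffunP => A; have /eqP := uu0 A isT; rewrite mulf_eq0 orbb ffunE => /eqP.
Qed.

HB.instance Definition _ := isDotProduct.Build R jspace jdot jdot_gt0.

Definition charvec (F : {set {set 'I_n}}) : jspace :=
  [ffun A : ksubset n k => (val A \in F)%:R].

Definition psi (S : {set 'I_n}) : jspace :=
  charvec [set A : {set 'I_n} | S \subset A].

Definition W (j : nat) : {vspace jspace} :=
  <<[seq psi T | T : {set 'I_n} in [set T : {set 'I_n} | #|T| == j]]>>%VS.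

Definition V (j : nat) : {vspace jspace} :=
  if j is i.+1 then (W j :&: orthov jdot (W i))%VS else W 0.

End Johnson.

(* Main.v *)
From HB Require Import structures.
Require Import Defs.
From mathcomp Require Import all_boot all_order all_algebra.
From mathcomp Require Import reals.
From mathcomp Require Import zify ring lra.

(** The Kneser operator [(K f)(B) = \sum_(A disjoint from B) f A] satisfies,
    by inclusion-exclusion,
      [K psi_S = 'C(n-k-j, k-j) * \sum_(T \subset S) (-1)^|T| psi_T], [j = |S|],
    so modulo [W_(j-1)] it acts on [W_j] as the scalar
    [lam_j = (-1)^j 'C(n-k-j, k-j)]; being self-adjoint and preserving
    [W_(j-1)], it acts on [V_j] exactly as [lam_j].  Write the characteristic
    vector as [chi = \sum_j x_j] with [x_j] in [V_j].  Intersection gives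
    [\sum_j lam_j |x_j|^2 = <chi, K chi> = 0], regularity gives [x_j = 0] for
    [1 <= j <= s], and [|x_0|^2 = |F|^2 / 'C(n, k)].  As [s] is odd, the least
    [lam_j] with [j > s] is [lam_(s+2)], which yields Hoffman's ratio bound; for
    [n > 2k] this minimum is attained at [j = s + 2] only. *)

Set Implicit Arguments.
Unset Strict Implicit.
Unset Printing Implicit Defensive.
Import Order.TTheory GRing.Theory Num.Theory.
Local Open Scope ring_scope.

(** * Counting lemmas and the arithmetic of the ratio bound *)

(** Removing [S] is a bijection onto the subsets of [D :\: S] of size [k - #|S|]. *)
Lemma card_setrange (T : finType) (S D : {set T}) (k : nat) :
  S \subset D -> (#|S| <= k)%N ->
  #|[set A : {set T} | [&& #|A| == k, S \subset A & A \subset D]]|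
  = 'C(#|D| - #|S|, k - #|S|).
Proof.
move=> SD Sk; rewrite -(cardsDS SD) -cards_draws.
rewrite -(@card_in_imset _ _ (fun A => A :\: S)); last first.
  move=> A B; rewrite !inE => /and3P[_ SA _] /and3P[_ SB _] eqAB.
  by rewrite -(setID A S) -(setID B S) eqAB (setIidPr SA) (setIidPr SB).
apply: eq_card => B; rewrite inE; apply/imsetP/andP.
  move=> [A]; rewrite inE => /and3P[/eqP Ak SA AD] ->.
  by rewrite setSD // cardsDS // Ak.
move=> [BD /eqP Bk]; move: BD; rewrite subsetD => /andP[BD BS].
exists (B :|: S); last first.
  by rewrite setDUl setDv setU0; apply/esym/setDidPl.
rewrite inE subsetUr subUset BD SD /= andbT cardsU.
by move: BS; rewrite -setI_eq0 => /eqP ->; rewrite cards0 Bk subn0 subnK.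
Qed.

(** Expand the product over all [i] of [1 - [i in X]]: any element of [X] gives a zero factor. *)
Lemma sum_sign_subset (R : comNzRingType) (T : finType) (X : {set T}) :
  \sum_(J : {set T} | J \subset X) (-1) ^+ #|J| = (X == set0)%:R :> R.
Proof.
transitivity (\prod_(i : T) (- (i \in X)%:R + 1) : R); last first.
  have [->|[x xX]] := set_0Vmem X.
    by rewrite eqxx big1 // => i _; rewrite inE oppr0 add0r.
  rewrite (bigD1 x) //= xX addNr mul0r; case: eqP => // X0.
  by rewrite X0 inE in xX.
rewrite bigA_distr [RHS](bigID (fun J : {set T} => J \subset X)) /=.
rewrite [X in _ + X]big1 ?addr0; last first.
  move=> J /subsetPn[x xJ xX]; rewrite (bigD1 x) //= xJ (negbTE xX).
  by rewrite oppr0 mul0r.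
apply: eq_bigr => J JX; rewrite -big_mkcond -prodr_const.
by apply: eq_bigr => i iJ; rewrite (subsetP JX).
Qed.

(** By symmetry the lower index becomes the fixed [a]. With [a = n - 2k] this compares the absolute
    values of the eigenvalues [lam]. *)
Lemma leq_bin_diag (a b c : nat) : (b <= c)%N -> ('C(a + b, b) <= 'C(a + c, c))%N.
Proof.
by move=> bc; rewrite -!(bin_sub (leq_addl a _)) !addnK leq_bin2l // leq_add2l.
Qed.

(** Pascal's rule from [b] to [b.+1] adds ['C(a + b, b.+1)], which is positive once [0 < a]. *)
Lemma ltn_bin_diag (a b c : nat) :
  (0 < a)%N -> (b < c)%N -> ('C(a + b, b) < 'C(a + c, c))%N.
Proof.
move=> a0 bc; apply: (@leq_trans 'C(a + b.+1, b.+1)); last exact: leq_bin_diag.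
by rewrite addnS binS -[X in (X < _)%N]add0n ltn_add2r bin_gt0; lia.
Qed.

(** Here [M] is the eigenvalue on constants, [-L] the least relevant one, [N] the number of
    [k]-sets, [f] the size of the family and [r] the contribution of the nonconstant components.
    Dropping [r] and cancelling [f] gives the bound; at equality the first term already equals
    [L * f]. *)
Lemma hoffman_arith (R : realFieldType) (L M N f r : R) :
  0 < L -> 0 <= M -> 0 < N -> 0 <= f -> 0 <= r ->
  (M + L) * (f ^+ 2 / N) + r = L * f ->
  f <= N / (1 + M / L) /\ (f = N / (1 + M / L) -> r = 0).
Proof.
move=> L0 M0 N0 f0 r0 fr.
have Ln0 : L != 0 by rewrite gt_eqF.
have Nn0 : N != 0 by rewrite gt_eqF.
have ML0 : 0 < M + L by lra.
have MLn0 : M + L != 0 by rewrite gt_eqF.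
have boundE : N / (1 + M / L) = N * L / (M + L)
  by field; rewrite MLn0 Ln0.
split=> [|fE].
  rewrite boundE; have [->|fn0] := eqVneq f 0; first by rewrite divr_ge0 ?mulr_ge0; lra.
  have fgt0 : 0 < f by rewrite lt_def fn0.
  have : (M + L) * (f ^+ 2 / N) <= L * f by lra.
  rewrite mulrA ler_pdivrMr // ler_pdivlMr // => h.
  by rewrite -(ler_pM2l fgt0); lra.
have fML : f * (M + L) = N * L by rewrite fE boundE divfK.
have : (M + L) * (f ^+ 2 / N) = L * f.
  have -> : (M + L) * (f ^+ 2 / N) = f * (M + L) * (f / N) by field.
  by rewrite fML; field.
lra.
Qed.

Section Kneser.
Variables (R : realType) (n k : nat).
Local Notation E := (jspace R n k).
Local Notation jdot := (@jdot R n k).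
Local Notation psi := (psi R k).
Local Notation W := (W R n k).
Local Notation V := (V R n k).

(** * Coordinates and inner product on the Johnson space *)

Lemma sum_ksubset (P : pred {set 'I_n}) (G : {set 'I_n} -> R) :
  \sum_(A : ksubset n k | P (val A)) G (val A)
  = \sum_(A : {set 'I_n} | (#|A| == k) && P A) G A.
Proof. by rewrite (@big_sub_cond _ _ _ _ (fun A : {set 'I_n} => #|A| == k)). Qed.

Lemma sum_ksubset1 (P : pred {set 'I_n}) :
  \sum_(A : ksubset n k | P (val A)) 1
  = #|[set A : {set 'I_n} | (#|A| == k) && P A]|%:R :> R.
Proof. by rewrite (sum_ksubset P (fun=> 1)) -sum1dep_card natr_sum. Qed.

Lemma psiE (S : {set 'I_n}) (A : ksubset n k) : psi S A = (S \subset val A)%:R.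
Proof. by rewrite ffunE inE. Qed.

Lemma card_ksubset (A : ksubset n k) : #|val A| = k.
Proof. exact: eqP (valP A). Qed.

Lemma jspaceZE (a : R) (u : E) (A : ksubset n k) : (a *: u) A = a * u A.
Proof. by rewrite ffunE. Qed.

Lemma jdotC (u v : E) : jdot u v = jdot v u.
Proof. by apply: eq_bigr => A _; rewrite mulrC. Qed.

Lemma jdot_ge0 (u : E) : 0 <= jdot u u.
Proof. by apply: sumr_ge0 => A _; rewrite -expr2 sqr_ge0. Qed.

Lemma jdot_eq0 (u : E) : (jdot u u == 0) = (u == 0).
Proof.
apply/idP/idP => [|/eqP ->]; last by rewrite linear0r.
by apply: contraTT => /jdot_gt0 /gt_eqF ->.
Qed.

(** * The filtration by the spaces [W j] *)

Lemma mem_W (S : {set 'I_n}) (j : nat) : #|S| = j -> psi S \in W j.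
Proof.
move=> Sj; apply: memv_span; apply/imageP; exists S => //.
by rewrite inE Sj.
Qed.

Lemma W_subvP (j : nat) (U : {vspace E}) :
  (forall S : {set 'I_n}, #|S| = j -> psi S \in U) -> (W j <= U)%VS.
Proof.
move=> WU; apply/span_subvP => x /imageP[S]; rewrite inE => /eqP Sj ->.
exact: WU.
Qed.

(** Double counting: a [k]-set containing [T] contains exactly ['C(k - i, j - i)] of the [j]-sets
    above [T], so [psi T] is a multiple of the sum of their [psi S]. *)
Lemma W_le (i j : nat) : (i <= j <= k)%N -> (W i <= W j)%VS.
Proof.
move=> /andP[ij jk]; apply: W_subvP => T Ti.
have C0 : 'C(k - i, j - i)%:R != 0 :> R by rewrite pnatr_eq0 -lt0n bin_gt0; lia.
have -> : psi T = 'C(k - i, j - i)%:R^-1 *: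
    \sum_(S : {set 'I_n} | (#|S| == j) && (T \subset S)) psi S.
  apply/ffunP => A; apply: (mulfI C0); rewrite jspaceZE mulVKf // sum_ffunE psiE.
  under eq_bigr do rewrite psiE.
  rewrite -natr_sum -big_mkcondr sum1dep_card.
  have [TA|TA] := boolP (T \subset val A).
    have := card_setrange (k := j) TA; rewrite card_ksubset Ti => <- //.
    rewrite mulr1;     by congr _%:R; apply: eq_card => S; rewrite !inE andbA.
  rewrite mulr0 (eq_card0 (A := _)) // => S; rewrite !inE.
  by apply: contraNF TA => /andP[/andP[_ TS]]; exact: subset_trans.
apply: rpredZ; apply: rpred_sum => S /andP[/eqP Sj _]; exact: mem_W.
Qed.

(** For a [k]-set [A], [psi A] is the standard basis vector at [A]. *)
Lemma W_full : W k = fullv.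
Proof.
apply/eqP; rewrite eqEsubv subvf /=; apply/subvP => f _.
have -> : f = \sum_(A : ksubset n k) (f A) *: psi (val A).
  apply/ffunP => B; rewrite sum_ffunE (bigD1 B) //= jspaceZE psiE subxx.
  rewrite big1 => [|A AB]; first by rewrite addr0 mulr1.
  rewrite jspaceZE psiE; case: (boolP (val A \subset val B)) => [AsB|_]; last exact: mulr0.
  case/negP: AB; apply/eqP/val_inj/eqP.
  by rewrite eqEcard AsB !card_ksubset leqnn.
apply: rpred_sum => A _; apply: rpredZ; apply: mem_W; exact: card_ksubset.
Qed.

(** * The Kneser operator and its action on [W j] *)

Definition kneser (f : E) : E :=
  [ffun B : ksubset n k => \sum_(A : ksubset n k | [disjoint val A & val B]) f A].

Fact kneser_linear : linear kneser.
Proof.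
move=> a u v; apply/ffunP => B; rewrite !ffunE scaler_sumr -big_split /=.
by apply: eq_bigr => A _; rewrite !ffunE.
Qed.
HB.instance Definition _ := GRing.isLinear.Build R E E _ kneser kneser_linear.

Lemma kneser_adj (u v : E) : jdot (kneser u) v = jdot u (kneser v).
Proof.
rewrite /jdot; under eq_bigr do rewrite ffunE mulr_suml big_mkcond.
under [RHS]eq_bigr do rewrite ffunE mulr_sumr big_mkcond.
rewrite exchange_big /=; apply: eq_bigr => A _; apply: eq_bigr => B _.
by rewrite disjoint_sym.
Qed.

(** At [B], the left side counts the [k]-sets that contain [S] and avoid [B]: none if [S] meets [B],
    and otherwise a number independent of [B]. The signed sum over [T] is the indicator that [S] and
    [B] are disjoint. *)
Lemma kneser_psi (S : {set 'I_n}) : (#|S| <= k)%N ->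
  kneser (psi S) = 'C(n - k - #|S|, k - #|S|)%:R *:
    \sum_(T : {set 'I_n} | T \subset S) (-1) ^+ #|T| *: psi T.
Proof.
move=> Sk; apply/ffunP => B; rewrite jspaceZE ffunE sum_ffunE.
transitivity ('C(n - k - #|S|, k - #|S|)%:R * (S :&: val B == set0)%:R : R); last first.
  congr (_ * _); rewrite -sum_sign_subset.
  under eq_bigl do rewrite subsetI.
  rewrite big_mkcondr; apply: eq_bigr => T _; rewrite jspaceZE psiE.
  by case: ifP => _; rewrite ?mulr1 ?mulr0.
under eq_bigr do rewrite psiE mulrb.
rewrite -big_mkcondr /= (sum_ksubset1 (fun A => [disjoint A & val B] && (S \subset A))).
have [SB|[x]] := set_0Vmem (S :&: val B).
  rewrite SB eqxx mulr1; congr _%:R.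
  have SBC : S \subset ~: val B by rewrite -disjoints_subset -setI_eq0 SB.
  have cB : #|~: val B| = (n - k)%N by rewrite cardsCs setCK card_ord card_ksubset.
  rewrite -cB -card_setrange //; apply: eq_card => A; rewrite !inE.
  by rewrite disjoints_subset [(S \subset A) && _]andbC.
move=> /[dup] xSB /setIP[xS xB]; rewrite (_ : _ == _ = false) ?mulr0; last first.
  by apply: contraTF xSB => /eqP ->; rewrite inE.
rewrite eq_card0 // => A; rewrite !inE; apply/negP => /and3P[_ AB SA].
by move: xB; rewrite (disjointFr AB) // (subsetP SA).
Qed.

Definition lam (j : nat) : R := (-1) ^+ j * 'C(n - k - j, k - j)%:R.

(** The term [T = S] of the expansion is [lam i.+1 *: psi S]; every other [T] has size at most
    [i]. *)
Lemma kneser_psi_lower (i : nat) (S : {set 'I_n}) : (i < k)%N -> #|S| = i.+1 ->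
  kneser (psi S) - lam i.+1 *: psi S \in W i.
Proof.
move=> ik Si; rewrite kneser_psi ?Si // (bigD1 S) //= Si scalerDr scalerA.
rewrite [_ * _]mulrC addrAC subrr add0r.
apply: rpredZ; apply: rpred_sum => T /andP[TS TnS]; apply: rpredZ.
have Ti : (#|T| < i.+1)%N by rewrite -Si proper_card // properEneq TnS.
by apply: (subvP (W_le (i := #|T|) _)); [lia | exact: mem_W].
Qed.

Lemma kneser_W0 (f : E) : f \in W 0 -> kneser f = lam 0 *: f.
Proof.
pose D : 'End(E) := linfun (kneser \- GRing.scale (lam 0) : E -> E).
suff : (W 0 <= lker D)%VS.
  by move=> /subvP WD /WD; rewrite memv_ker lfunE /= subr_eq0 => /eqP.
apply: W_subvP => S S0; rewrite memv_ker lfunE /= subr_eq0.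
move: S0 => /cards0_eq ->; rewrite kneser_psi cards0 // /lam expr0 mul1r.
under eq_bigl do rewrite subset0.
by rewrite big_pred1_eq cards0 expr0 scale1r.
Qed.

Lemma kneser_W_lower (i : nat) (f : E) : (i < k)%N -> f \in W i.+1 ->
  kneser f - lam i.+1 *: f \in W i.
Proof.
(* Stated as an inclusion in the preimage of a subspace under a linear map, the claim need only be
   checked on the generators [psi S]. *)
move=> ik; pose D : 'End(E) := linfun (kneser \- GRing.scale (lam i.+1) : E -> E).
suff : (W i.+1 <= D @^-1: W i)%VS.
  by move=> /subvP WD /WD; rewrite -memv_preim lfunE.
apply: W_subvP => S Si; rewrite -memv_preim lfunE; exact: kneser_psi_lower.
Qed.

Lemma kneser_W (j : nat) (f : E) : (j <= k)%N -> f \in W j -> kneser f \in W j.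
Proof.
case: j => [|i] ik fW; first by rewrite kneser_W0 // rpredZ.
rewrite -[kneser f](subrK (lam i.+1 *: f)) rpredD ?rpredZ //.
by apply: (subvP (W_le (i := i) _)); [lia | exact: kneser_W_lower].
Qed.

(** * Eigenspaces and the orthogonal decomposition *)

Lemma V_sub_W (j : nat) : (V j <= W j)%VS.
Proof. by case: j => [|j] //=; exact: capvSl. Qed.

Lemma jdot_VW (i : nat) (u v : E) : u \in V i.+1 -> v \in W i -> jdot u v = 0.
Proof. by rewrite memv_cap => /andP[_ /mem_orthovP]; apply. Qed.

(* The error term [w = K f - lam_j f] is in [W_(j-1)] and orthogonal to it. *)
Lemma kneser_V (j : nat) (f : E) : (j <= k)%N -> f \in V j ->
  kneser f = lam j *: f.
Proof.
case: j => [|i] ik fV; first exact: kneser_W0.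
have fW := subvP (V_sub_W _) _ fV; have := kneser_W_lower ik fW.
set w := _ - _ => wW; apply/eqP; rewrite -subr_eq0 -jdot_eq0 -/w.
have -> : jdot w w = jdot (kneser f) w - lam i.+1 * jdot f w.
  by rewrite {1}/w linearBl linearZl_LR.
by rewrite kneser_adj !(jdot_VW fV) ?mulr0 ?subr0 // kneser_W // ltnW.
Qed.

Lemma jdot_V (i j : nat) (u v : E) : (i <= k)%N -> (j <= k)%N -> i != j ->
  u \in V i -> v \in V j -> jdot u v = 0.
Proof.
wlog ij : i j u v / (i < j)%N.
  move=> H ik jk; rewrite neq_ltn => /orP[ij|ij] uV vV.
    by apply: H uV vV; rewrite // ltn_eqF.
  by rewrite jdotC; apply: H vV uV; rewrite // ltn_eqF.
case: j ij => // j ij ik jk _ uV vV; rewrite jdotC; apply: (jdot_VW vV).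
apply: (subvP (W_le (i := i) _)); first lia.
exact: subvP (V_sub_W _) _ uV.
Qed.

(** Gram-Schmidt: [q] is the part of the new vector [x] orthogonal to the span of [X], and the
    residue [w] of [v] is corrected by its projection on [q]. *)
Lemma span_orthov_decomp (X : seq E) (v : E) :
  exists2 u, u \in <<X>>%VS & v - u \in orthov jdot <<X>>.
Proof.
elim: X v => [|x X IH] v.
  by exists 0; rewrite ?mem0v // span_nil orthov0 memvf.
have [p pX qX] := IH x; have [u uX wX] := IH v.
set q := x - p in qX; set w := v - u in wX.
have sX : (<<X>> <= <<x :: X>>)%VS by rewrite span_cons addvSr.
have qxX : q \in <<x :: X>>%VS.
  by rewrite rpredB ?(subvP sX _ pX) // memv_span ?mem_head.
pose c := jdot w q / jdot q q; pose r := w - c *: q.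
have rX y : y \in <<X>>%VS -> jdot r y = 0.
  by move=> yX; apply: mem_orthovP yX; rewrite rpredB ?rpredZ.
have rq : jdot r q = 0.
  have -> : jdot r q = jdot w q - c * jdot q q by rewrite linearBl linearZl_LR.
  (* If [q = 0], then [x] is already in the span of [X] and the value of [c] does not matter. *)
  have [->|q0] := eqVneq q 0; first by rewrite !linear0r mulr0 subr0.
  by rewrite divfK ?subrr // jdot_eq0.
exists (u + c *: q); first by rewrite rpredD ?rpredZ ?(subvP sX _ uX).
rewrite opprD addrA -/w -/r; apply/mem_orthovP => z.
rewrite span_cons => /memv_addP[z' /vlineP[a ->] [y yX ->]].
transitivity (a * jdot r x + jdot r y); first by rewrite linearDr linearZr_LR.
have -> : jdot r x = jdot r q + jdot r p by rewrite -linearDr subrK.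
by rewrite rq (rX _ pX) (rX _ yX) !addr0 mulr0.
Qed.

(** Project a vector of [W j.+1] on [W j]: the projection decomposes by induction, and the residue
    is in [V j.+1]. *)
Lemma W_sumV (j : nat) : (j <= k)%N -> (W j <= \sum_(i < j.+1) V i)%VS.
Proof.
elim: j => [|j IH] jk; first by rewrite big_ord1.
rewrite big_ord_recr /=; apply/subvP => v vW.
have [u uW vuW] := span_orthov_decomp
  [seq psi T | T : {set 'I_n} in [set T : {set 'I_n} | #|T| == j]] v.
rewrite -[v](subrK u) addrC memv_add //.
  exact: subvP (IH (ltnW jk)) _ uW.
rewrite memv_cap vuW andbT rpredB //.
by apply: (subvP (W_le (i := j) _)); [lia | exact: uW].
Qed.

Lemma V_decomp (f : E) : exists2 x : 'I_k.+1 -> E,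
  forall i, x i \in V i & f = \sum_i x i.
Proof.
have /(subvP (W_sumV (leqnn k))) /memv_sumP[x xV ->] : f \in W k.
  by rewrite W_full memvf.
by exists x => // i; exact: xV.
Qed.

(** * Characteristic vectors, intersection and regularity *)

Lemma jdot_charvec (F : {set {set 'I_n}}) (S : {set 'I_n}) :
  (forall A, A \in F -> #|A| = k) ->
  jdot (charvec R k F) (psi S) = #|[set A in F | S \subset A]|%:R.
Proof.
move=> hF; rewrite /jdot; under eq_bigr do rewrite psiE ffunE -natrM mulnb mulrb.
rewrite -big_mkcond /= (sum_ksubset1 (fun A => (A \in F) && (S \subset A))).
congr _%:R; apply: eq_card => A; rewrite !inE andbA.
by case: (boolP (A \in F)) => [/hF ->|]; rewrite ?eqxx ?andbF.
Qed.

Lemma jdot_charvec_self (F : {set {set 'I_n}}) :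
  (forall A, A \in F -> #|A| = k) ->
  jdot (charvec R k F) (charvec R k F) = #|F|%:R.
Proof.
move=> hF; rewrite /jdot; under eq_bigr do rewrite ffunE -natrM mulnb andbb mulrb.
rewrite -big_mkcond /= (sum_ksubset1 (fun A => A \in F)).
congr _%:R; apply: eq_card => A; rewrite !inE.
by case: (boolP (A \in F)) => [/hF ->|]; rewrite ?eqxx ?andbF.
Qed.

Lemma jdot_psi0 (S : {set 'I_n}) : (#|S| <= k)%N ->
  jdot (psi set0) (psi S) = 'C(n - #|S|, k - #|S|)%:R.
Proof.
move=> Sk; rewrite /jdot; under eq_bigr do rewrite !psiE sub0set mul1r mulrb.
rewrite -big_mkcond /= (sum_ksubset1 (fun A => S \subset A)).
have := card_setrange (subsetT S) Sk; rewrite cardsT card_ord => <-.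
by congr _%:R; apply: eq_card => A; rewrite !inE subsetT andbT.
Qed.

Lemma kneser_intersecting (F : {set {set 'I_n}}) : intersecting F ->
  jdot (kneser (charvec R k F)) (charvec R k F) = 0.
Proof.
move=> hF; apply: big1 => B _; rewrite !ffunE.
have [BF|_] := boolP (val B \in F); last exact: mulr0.
rewrite big1 ?mul0r // => A AB; rewrite ffunE.
case: (boolP (val A \in F)) => // AF.
by move: (hF _ _ AF BF); rewrite setI_eq0 AB.
Qed.

(** Regularity makes [chi] pair equally with all [psi S], [#|S| = s]. Subtracting a suitable
    multiple of the all-ones vector [psi set0] thus gives [h] orthogonal to [W s], which contains
    [V i]; and [V i] is orthogonal to [psi set0] as [0 < i]. *)
Lemma regular_jdot_V (s i : nat) (F : {set {set 'I_n}}) (g : E) :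
  (k <= n)%N -> (s <= k)%N -> (forall A, A \in F -> #|A| = k) ->
  subset_regular s F -> (0 < i <= s)%N -> g \in V i ->
  jdot (charvec R k F) g = 0.
Proof.
move=> kn sk hF [d hd] /andP[i0 si] gV.
pose h : E := charvec R k F - (d%:R / 'C(n - s, k - s)%:R) *: psi set0.
have hE u : jdot h u = jdot (charvec R k F) u
                       - d%:R / 'C(n - s, k - s)%:R * jdot (psi set0) u.
  by rewrite linearBl linearZl_LR.
have /mem_orthovP hW : h \in orthov jdot (W s).
  (* Exchanging the two sides of the orthogonality reduces it to the generators of [W s]. *)
  rewrite mem_orthov_sym; apply: W_subvP => S Ss.
  rewrite mem_orthov1_sym mem_orthov1 -[_ == 0]/(jdot h (psi S) == 0) hE
    jdot_charvec // jdot_psi0 Ss // hd //.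
  by rewrite divfK ?subrr // pnatr_eq0 -lt0n bin_gt0; lia.
have gW : g \in W s.
  by apply: (subvP (W_le (i := i) _)); [lia | exact: subvP (V_sub_W _) _ gV].
have g0 : jdot (psi set0) g = 0.
  have p0 : psi set0 \in V 0 by apply: mem_W; rewrite cards0.
  by apply: (jdot_V _ _ _ p0 gV); lia.
by have : jdot h g = 0; [exact: hW | rewrite hE g0 mulr0 subr0].
Qed.

(** * Comparison of the eigenvalues *)

(** For even [i], [lam i] is nonnegative. An odd [i] differs from the even [m.-1], so [i > m], and
    the absolute value of [lam] strictly decreases because [n - 2 * k] is positive. *)
Lemma lam_add_gt0 (m i : nat) : (2 * k < n)%N -> odd m -> (m <= k)%N ->
  (m.-1 <= i <= k)%N -> i != m -> 0 < lam i + 'C(n - k - m, k - m)%:R.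
Proof.
move=> nk om mk /andP[mi ik] im.
have -> : (n - k - m = (n - 2 * k) + (k - m))%N by lia.
have b0 : (0 < 'C(n - 2 * k + (k - m), k - m))%N by rewrite bin_gt0 leq_addl.
rewrite /lam -signr_odd; have [oi|oi] := boolP (odd i); last first.
  by rewrite mul1r ltr_wpDl ?ler0n ?ltr0n.
rewrite expr1 mulN1r addrC subr_gt0 ltr_nat.
have -> : (n - k - i = (n - 2 * k) + (k - i))%N by lia.
apply: ltn_bin_diag; lia.
Qed.

Lemma lam_add_ge0 (m i : nat) : (2 * k <= n)%N -> odd m -> (m <= k)%N ->
  (m.-1 <= i <= k)%N -> 0 <= lam i + 'C(n - k - m, k - m)%:R.
Proof.
move=> nk om mk /andP[mi ik].
have -> : (n - k - m = (n - 2 * k) + (k - m))%N by lia.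
rewrite /lam -signr_odd; have [oi|oi] := boolP (odd i); last first.
  by rewrite mul1r addr_ge0.
rewrite expr1 mulN1r addrC subr_ge0 ler_nat.
have -> : (n - k - i = (n - 2 * k) + (k - i))%N by lia.
apply: leq_bin_diag; lia.
Qed.

End Kneser.

(** * The ratio bound and the case of equality *)

Theorem theorem21 (R : realType) (s n k : nat) (F : {set {set 'I_n}})
    (hs1 : (1 <= s)%N) (hsodd : odd s)
    (hnk : (2 * k <= n)%N) (hks : (s + 2 <= k)%N)
    (hF : forall A : {set 'I_n}, A \in F -> #|A| = k)
    (hreg : subset_regular s F) (hint : intersecting F) :
  let bound : R := 'C(n, k)%:R /
    (1 + 'C(n - k, k)%:R / 'C(n - k - s - 2, k - s - 2)%:R) in
  #|F|%:R <= bound /\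
  ((2 * k < n)%N -> #|F|%:R = bound ->
   charvec R k F \in (V R n k 0 + V R n k (s + 2))%VS).
Proof.
move=> bound; set chi := charvec R k F.
have [x xV chiE] := V_decomp chi.
have xx i j : i != j -> jdot (x i) (x j) = 0.
  by move=> ij; apply: (jdot_V _ _ _ (xV i) (xV j)); rewrite ?leq_ord.
have chix i : jdot chi (x i) = jdot (x i) (x i).
  rewrite chiE linear_sumlz (bigD1 i) //= big1 ?addr0 // => j ji; exact: xx.
set L : R := 'C(n - k - s - 2, k - s - 2)%:R in bound *.
set N : R := 'C(n, k)%:R in bound *; set f : R := #|F|%:R.
have sumx : \sum_i jdot (x i) (x i) = f.
  rewrite /f -(jdot_charvec_self R hF) -/chi {2}chiE linear_sumr /=.
  by apply: eq_bigr => i _; rewrite chix.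
have sumlx : \sum_(i < k.+1) lam R n k i * jdot (x i) (x i) = 0.
  have Kchi : kneser chi = \sum_(i < k.+1) lam R n k i *: x i.
    rewrite chiE linear_sum; apply: eq_bigr => i _.
    exact: kneser_V (leq_ord i) (xV i).
  transitivity (jdot (kneser chi) chi); last exact: kneser_intersecting.
  rewrite kneser_adj Kchi linear_sumr /=.
  by apply: eq_bigr => i _; rewrite linearZr_LR /= chix.
have N0 : 0 < N by rewrite ltr0n bin_gt0; lia.
(* The component in [V 0] is [c] times the all-ones vector; pairing [chi] with that vector gives
   [c = f / N]. *)
have x0 : jdot (x ord0) (x ord0) = f ^+ 2 / N.
  have psi0V : psi R k set0 \in V R n k 0 by apply: mem_W; rewrite cards0.
  have /vlineP[c x0E] : x ord0 \in <[psi R k set0]>%VS.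
    apply: (subvP (W_subvP (j := 0) _)) (xV ord0) => S /cards0_eq ->.
    exact: memv_line.
  have NE : jdot (psi R k (set0 : {set 'I_n})) (psi R k set0) = N.
    by rewrite jdot_psi0 cards0 // !subn0.
  have fE : f = c * N.
    transitivity (jdot chi (psi R k set0)).
      rewrite jdot_charvec // /f; congr _%:R; apply: eq_card => A.
      by rewrite !inE sub0set andbT.
    rewrite chiE linear_sumlz (bigD1 ord0) //= big1 => [|i i0].
      by rewrite x0E linearZl_LR /= NE addr0.
    exact: jdot_V (leq_ord i) (leq0n k) i0 (xV i) psi0V.
  by rewrite fE x0E linearZl_LR linearZr_LR /= NE; field; rewrite gt_eqF.
have xreg (i : 'I_k.+1) : (0 < i <= s)%N -> jdot (x i) (x i) = 0.
  by move=> si; rewrite -chix (regular_jdot_V _ _ hF hreg si) //; lia.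
have LE : L = 'C(n - k - (s + 2), k - (s + 2))%:R by rewrite !subnDA.
have L0 : 0 < L by rewrite ltr0n bin_gt0; lia.
have lam0 : lam R n k 0 = 'C(n - k, k)%:R by rewrite /lam expr0 mul1r !subn0.
(* With [m = s + 2], odd like [s], the condition [s < i] is [m.-1 <= i]. *)
have lamL i : (s < i <= k)%N -> 0 <= lam R n k i + L.
  by move=> /andP[si ik]; rewrite LE lam_add_ge0 //; lia.
set M : R := 'C(n - k, k)%:R in bound lam0 *.
have M0 : 0 <= M by exact: ler0n.
(* Adding [L] times the sum of the squared norms, which is [L * f], to the vanishing sum weighted by
   [lam] shifts all eigenvalues by [L]; every term of index other than 0 is then nonnegative. *)
pose rest := \sum_(i < k.+1 | i != ord0) (lam R n k i + L) * jdot (x i) (x i).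
have restE : (M + L) * (f ^+ 2 / N) + rest = L * f.
  rewrite -x0 -lam0 -(bigD1 ord0 (P := predT)) //=.
  under eq_bigr do rewrite mulrDl.
  by rewrite big_split /= sumlx add0r -mulr_sumr sumx.
have term_ge0 (i : 'I_k.+1) : i != ord0 ->
    0 <= (lam R n k i + L) * jdot (x i) (x i).
  rewrite -val_eqE /= -lt0n => i0; have [si|si] := leqP i s.
    by rewrite xreg ?i0 // mulr0.
  by rewrite mulr_ge0 ?jdot_ge0 // lamL // si leq_ord.
have rest0 : 0 <= rest by exact: sumr_ge0.
have [le_f eq_f] := hoffman_arith L0 M0 N0 (ler0n R _) rest0 restE.
split=> // nk /eq_f rest_eq0.
(* A vanishing sum of nonnegative terms has only zero terms, and for [i > s] other than [s + 2] the
   shifted eigenvalue is positive. *)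
have xz (i : 'I_k.+1) : i != 0%N :> nat -> i != (s + 2)%N :> nat -> x i = 0.
  move=> i0 is2; apply/eqP; rewrite -jdot_eq0; apply/eqP.
  have [si|si] := leqP i s; first by rewrite xreg // si lt0n i0.
  have /(_ i i0)/eqP := psumr_eq0P term_ge0 rest_eq0.
  rewrite mulf_eq0 => /orP[|/eqP //].
  by rewrite LE gt_eqF // lam_add_gt0 // ?addn2 /= ?oddS ?si ?leq_ord //; lia.
pose m : 'I_k.+1 := inord (s + 2).
have mE : m = (s + 2)%N :> nat by rewrite inordK.
rewrite chiE (bigD1 ord0) //= (bigD1 m) /=; last by rewrite -val_eqE /= mE addn2.
rewrite big1 ?addr0 => [|i /andP[i0 im]]; last first.
  by apply: xz; [exact: i0 | rewrite -mE].
apply: memv_add; first exact: (xV ord0).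
by rewrite -mE; exact: xV.
Qed.
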